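(* Assume the Continuum Hypothesis. Let $X$ be a compact Hausdorff $F$-space of weight $\mathfrak{c}$. Then $\dim X=\operatorname{ind}X=\operatorname{Ind}X$.
   Context: $\mathfrak{c}=2^{\aleph_0}$. A space is an $F$-space if separated $F_\sigma$-sets in it have disjoint closures, where $A$ and $B$ are separated if $A\cap\overline{B}=\emptyset=\overline{A}\cap B$. The weight of a space is the minimal cardinality of a base. All three dimension functions assign $-1$ exactly to the empty space and may take the value $\infty$. Covering dimension: $\dim X\le n$ iff every finite open cover of the normal space $X$ has an open refinement in which every point of $X$ lies in at most $n+1$ members. Small inductive dimension: $\operatorname{ind}X\le n$ iff for every point $x$ and every open $V\ni x$ there is an open $U$ with $x\in U\subseteq V$ and $\operatorname{ind}\operatorname{Fr}U\le n-1$. Large inductive dimension: $\operatorname{Ind}X\le n$ iff for every closed $A$ and every open $V\supseteq A$ there is an open $U$ with $A\subseteq U\subseteq V$ and $\operatorname{Ind}\operatorname{Fr}U\le n-1$. Here $\operatorname{Fr}U$ is the boundary of $U$. *)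

(* Defs.v *)
From HB Require Import structures.
From mathcomp Require Import all_boot all_order all_algebra.
From mathcomp Require Import all_classical all_reals all_analysis.
From mathcomp Require Import borel_hierarchy.

Set Implicit Arguments.
Unset Strict Implicit.
Unset Printing Implicit Defensive.

Import Order.TTheory GRing.Theory Num.Theory.

Local Open Scope classical_set_scope.
Local Open Scope card_scope.
Local Open Scope ring_scope.

(* The cardinal 2^aleph_0 is represented by the power set of nat. *)
Definition continuum : set (set nat) := [set: set nat].

Definition continuum_hypothesis : Prop :=
  forall A : set (set nat), countable A \/ A #= continuum.

Definition F_space (X : topologicalType) : Prop :=
  forall A B : set X, Fsigma A -> Fsigma B -> separated A B ->
    closure A `&` closure B = set0.

Definition has_weight (X : topologicalType) U (K : set U) : Prop :=
  (exists2 B : set (set X), basis B & B #= K) /\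
  (forall B : set (set X), basis B -> K #<= B).

Definition boundary (X : topologicalType) (U : set X) : set X :=
  closure U `&` closure (~` U).

(* In the predicates below the index is shifted by one, so that k : nat stands *)
(* for the bound k - 1: index 0 means "dimension <= -1", index n.+1 means      *)
(* "dimension <= n".                                                           *)

Definition covdim_le (k : nat) (X : topologicalType) : Prop :=
  if k is n.+1 then
    forall C : set (set X),
      finite_set C -> C `<=` open -> \bigcup_(U in C) U = [set: X] ->
      exists D : set (set X),
        [/\ D `<=` open, \bigcup_(V in D) V = [set: X],
            forall V, D V -> exists2 U, C U & V `<=` U &
            forall x : X, [set V | D V /\ V x] #<= `I_n.+1]
  else [set: X] = set0.

(* The canonical topology of set_type (boundary U) is the one induced by X;    *)
(* by contrast, subspace (boundary U) would retopologize the whole of X.       *)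

Fixpoint ind_le (k : nat) (X : topologicalType) : Prop :=
  if k is n.+1 then
    forall (x : X) (V : set X), open V -> V x ->
      exists U : set X,
        [/\ open U, U x, U `<=` V & ind_le n (set_type (boundary U))]
  else [set: X] = set0.

Fixpoint Ind_le (k : nat) (X : topologicalType) : Prop :=
  if k is n.+1 then
    forall A V : set X, closed A -> open V -> A `<=` V ->
      exists U : set X,
        [/\ open U, A `<=` U, U `<=` V & Ind_le n (set_type (boundary U))]
  else [set: X] = set0.

(* The least k - 1 such that P k holds, and +oo if there is none. *)
Definition dim_value (P : nat -> Prop) : \bar int :=
  if pselect (exists k, `[< P k >]) is left exP
  then ((ex_minn exP)%:Z - 1)%:E
  else +oo%E.

Definition covering_dimension (X : topologicalType) : \bar int :=
  dim_value (fun k => covdim_le k X).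

Definition small_inductive_dimension (X : topologicalType) : \bar int :=
  dim_value (fun k => ind_le k X).

Definition large_inductive_dimension (X : topologicalType) : \bar int :=
  dim_value (fun k => Ind_le k X).

(* Main.v *)
Require Import Defs.
From HB Require Import structures.
From mathcomp Require Import all_boot all_order all_algebra.
From mathcomp Require Import all_classical all_reals all_analysis.
From mathcomp Require Import wochoice borel_hierarchy.

(* The inequalities dim <= ind <= Ind hold in every compact Hausdorff space.
   For Ind <= dim, suppose dim X <= n and let A, B be disjoint and closed.
   Given a finite open cover, refine it by an open cover D with at most n + 1
   members through each point, none of them meeting both A and B.  A partition
   lying in the union of the members of D that meet A, but off a closed
   shrinking of that union, is covered by the remaining members, at most n of
   which pass through each of its points.  By CH a cofinal family of finite
   covers is well-ordered so that each has only countably many predecessors,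
   and the step is iterated: the two sides of the partition grow as disjoint
   open F_sigma sets, which the F-space property keeps at disjoint closures.
   What is left between the final two sides has dim <= n - 1. *)

Set Implicit Arguments.
Unset Strict Implicit.
Unset Printing Implicit Defensive.

Local Open Scope classical_set_scope.
Local Open Scope card_scope.

(** * Counting the members of a family through a point *)

Lemma card_le_sub_image T U (A : set T) (B : set U) (f : T -> U) (n : nat) :
  B `<=` f @` A -> A #<= `I_n -> B #<= `I_n.
Proof.
move=> BfA An; apply: card_le_trans (subset_card_le BfA) _.
exact: card_le_trans (card_image_le f A) An.
Qed.

Lemma card_le_proper T (A B : set T) (a : T) (n : nat) :
  A `<=` B -> B a -> ~ A a -> B #<= `I_n.+1 -> A #<= `I_n.
Proof.
move=> AB Ba Aa Bn.
have /finite_setP[m Am] : finite_set A.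
  apply/finite_set_leP; exists n.+1; exact: card_le_trans (subset_card_le AB) Bn.
have Sm : (a |` A) #= `I_m.+1.
  apply/eq_cardSP; exists a; first by left.
  suff -> : (a |` A) `\ a = A by [].
  apply/seteqP; split => [x [[xa nxa|//]]|x Ax]; first by case: (nxa xa).
  by split; [right|move=> xa; apply: Aa; rewrite -xa].
have : a |` A #<= `I_n.+1.
  by apply: card_le_trans Bn; apply: subset_card_le => x [->|/AB].
by rewrite (card_le_eql Sm) card_le_II ltnS (card_le_eql Am) card_le_II.
Qed.

Lemma card_leU1 T (A B C : set T) (n : nat) :
  A `<=` B `|` C -> B #<= `I_n -> is_subset1 C -> A #<= `I_n.+1.
Proof.
move=> ABC Bn C1.
have [/subset_card_le AB|/existsNP[a /not_implyP[Aa Ba]]] := pselect (A `<=` B).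
  apply: card_le_trans AB (card_le_trans Bn _).
  by rewrite card_le_II.
have Ca : C a by case: (ABC a Aa).
have {ABC}AaB : A `\ a `<=` B.
  by move=> x [Ax xa]; case: (ABC x Ax) => // Cx; case: xa; exact: C1.
have Aan : A `\ a #<= `I_n := card_le_trans (subset_card_le AaB) Bn.
have /finite_setP[m Am] : finite_set (A `\ a) by apply/finite_set_leP; exists n.
have Sm : A #= `I_m.+1 by apply/eq_cardSP; exists a.
by rewrite (card_le_eql Sm) card_le_II ltnS -card_le_II -(card_le_eql Am).
Qed.

(** * Finite subcovers, normality and F_sigma sets *)

Lemma compact_finite_subcover (X : topologicalType) (K : set X) (W : X -> set X) :
  compact K -> (forall x, K x -> open (W x) /\ W x x) ->
  exists s : set X, [/\ finite_set s, s `<=` K & K `<=` \bigcup_(x in s) W x].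
Proof.
move=> /compact_near_coveringP cK KW.
(* The finite subsets of [K], directed by inclusion, generate this filter; a statement that holds
   near it holds for some finite [s]. *)
pose F : set_system (set X) :=
  filter_from [set s | finite_set s /\ s `<=` K] (fun s => [set t | s `<=` t]).
have FF : Filter F.
  apply: filter_from_filter; first by exists set0; split.
  move=> s t [fs sK] [ft tK]; exists (s `|` t).
    by split; [rewrite finite_setU | rewrite subUset].
  by move=> u /= stu; split => x ?; apply: stu; [left|right].
have [|s [fs sK] sP] := cK _ F (fun t y => (\bigcup_(x in t) W x) y) FF.
  move=> x Kx; have [oW Wx] := KW x Kx.
  exists (W x, [set t | [set x] `<=` t]).
    split => /=; first exact: open_nbhs_nbhs.
    by exists [set x] => //; split=> [|_ ->//]; exact: finite_set1.
  by move=> [y t] /= [Wy xt]; exists x => //; exact: xt.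
by exists s; split => //; exact: (sP s).
Qed.

Lemma normal_shrink (X : topologicalType) (F G : set X) : normal_space X ->
  closed F -> open G -> F `<=` G ->
  exists U, [/\ open U, F `<=` U & closure U `<=` G].
Proof.
move=> nX cF oG FG.
have [|U FU UG] := nX F cF G.
  by move=> x Fx; apply: open_nbhs_nbhs; split => //; exact: FG.
exists (interior U); split; [exact: open_interior| |].
  by move=> x Fx; exact: FU.
by apply: subset_trans UG; apply: closureS; exact: interior_subset.
Qed.

(** Iterated shrinking gives open sets, each containing the closure of the one before; their union
    is then also the union of these closures. *)
Lemma normal_open_Fsigma (X : topologicalType) (F G : set X) : normal_space X ->
  closed F -> open G -> F `<=` G ->
  exists U, [/\ open U, Fsigma U, F `<=` U & U `<=` G].
Proof.
move=> nX cF oG FG.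
have [U0 [oU0 FU0 U0G]] := normal_shrink nX cF oG FG.
pose T := {U : set X | open U /\ closure U `<=` G}.
pose R (U V : T) := closure (sval U) `<=` sval V.
have ex (U : T) : {V : T | R U V}.
  case: U => U [oU UG].
  have /cid[V [oV UV VG]] := normal_shrink nX (@closed_closure _ U) oG UG.
  by exists (exist _ V (conj oV VG)).
have [f [f0 fR]] := dependent_choice ex (exist _ U0 (conj oU0 U0G)).
exists (\bigcup_n sval (f n)); split.
- by apply: bigcup_open => n _; case: (svalP (f n)).
- exists (fun n => closure (sval (f n))); first by move=> n; exact: closed_closure.
  apply/seteqP; split => x [n _ fx]; first by exists n => //; exact: subset_closure.
  by exists n.+1 => //; exact: fR.
- by move=> x /FU0 U0x; exists 0 => //; rewrite f0.
- by move=> x [n _ /subset_closure]; case: (svalP (f n)) => _; apply.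
Qed.

Lemma Fsigma_bigcup (X : topologicalType) (I : Type) (D : set I) (F : I -> set X) :
  countable D -> (forall i, D i -> Fsigma (F i)) -> Fsigma (\bigcup_(i in D) F i).
Proof.
move=> /countable_injP[f finj] DF.
have ex (n : nat) : exists G : nat -> set X, (forall m, closed (G m)) /\
    \bigcup_(i in [set i | D i /\ f i = n]) F i = \bigcup_m G m.
  have [[i [Di fi]]|nD] := pselect (exists i, D i /\ f i = n).
    have [G cG FG] := DF i Di; exists G; split => //; rewrite -FG.
    apply/seteqP; split => [x [j [Dj fj] Fj]|x Fx]; last by exists i.
    by rewrite (finj i j) ?inE// fj.
  exists (fun=> set0); split; first by move=> _; exact: closed0.
  by apply/seteqP; split => [x [i Di _]|x [m _ //]]; case: nD; exists i.
have [G GP] := choice ex.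
exists (fun k => if unpickle k is Some p then G p.1 p.2 else set0).
  move=> k; case: unpickle => [p|]; last exact: closed0.
  by case: (GP p.1).
apply/seteqP; split => [x [i Di Fx]|x [k _]].
  have : (\bigcup_m G (f i) m) x by case: (GP (f i)) => _ <-; exists i.
  by move=> [m _ Gx]; exists (pickle (f i, m)) => //; rewrite pickleK.
case: unpickle => [[n m]/=|//] Gx.
have : (\bigcup_m G n m) x by exists m.
by case: (GP n) => _ <- [i [Di _] Fx]; exists i.
Qed.

Lemma FsigmaU (X : topologicalType) (A B : set X) :
  Fsigma A -> Fsigma B -> Fsigma (A `|` B).
Proof.
move=> FA FB; rewrite -bigcup2inE; apply: Fsigma_bigcup; first exact: countableP.
by move=> [|[|//]].
Qed.

(** * Covering dimension of a subset, in terms of open sets of the whole space *)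

(** The members are open in [X], but the order is counted only at points of [L]. As in [covdim_le],
    the index [n] belongs to dimension at most n - 1. *)
Definition order_refinement (X : topologicalType) (n : nat) (L : set X)
    (C : set (set X)) : Prop :=
  exists D : set (set X),
    [/\ D `<=` open, L `<=` \bigcup_(V in D) V,
        forall V, D V -> exists2 U, C U & V `<=` U &
        forall x, L x -> [set V | D V /\ V x] #<= `I_n].

Definition covdim_in (X : topologicalType) (n : nat) (K : set X) : Prop :=
  forall C : set (set X), finite_set C -> C `<=` open ->
    K `<=` \bigcup_(U in C) U -> order_refinement n K C.

Lemma order_refinementS (X : topologicalType) (n : nat) (L M : set X)
    (C : set (set X)) :
  L `<=` M -> order_refinement n M C -> order_refinement n L C.
Proof.
move=> LM [D [oD MD DC Dn]]; exists D; split => //.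
  exact: subset_trans LM MD.
by move=> x /LM; exact: Dn.
Qed.

Lemma covdim_leE (X : topologicalType) (n : nat) :
  covdim_le n X <-> covdim_in n [set: X].
Proof.
case: n => [|n] /=.
  split=> [X0 C _ _ _|X0].
    by exists set0; split=> // x; rewrite X0.
  (* A cover with no member through any point leaves no points. *)
  have [||D [_ covD _ D0]] := X0 [set setT] (finite_set1 _).
  - by move=> _ ->; exact: openT.
  - by move=> x _; exists setT.
  apply/seteqP; split => // x _; have [V DV Vx] := covD x I.
  have := D0 x I; rewrite II0 card_le0 => /eqP E.
  by have : set0 V by rewrite -E.
split=> dX C fC oC covC.
  have [|D [oD covD DC Dn]] := dX C fC oC; first exact/seteqP.
  by exists D; split => //; rewrite covD.
have [|D [oD covD DC Dn]] := dX C fC oC; first by rewrite covC.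
by exists D; split => //; [exact/seteqP | move=> x; exact: Dn].
Qed.

Lemma set_type_inE (X : Type) (K : set X) (x : X) : K x ->
  exists y : set_type K, set_val y = x.
Proof. by move=> Kx; exists (exist _ x (mem_set Kx)). Qed.

Lemma set_val_in (X : Type) (K : set X) (y : set_type K) : K (set_val y).
Proof. exact: set_valP. Qed.

Lemma covdim_le_set_type (X : topologicalType) (n : nat) (K : set X) :
  covdim_le n (set_type K) <-> covdim_in n K.
Proof.
rewrite covdim_leE; split=> dK C fC oC covC.
  have [|||D [oD covD DC Dn]] := dK ((fun U => set_val @^-1` U) @` C).
  - exact: finite_image.
  - by move=> _ [U CU <-]; exists U => //; exact: oC.
  - move=> y _; have [U CU Uy] := covC _ (set_val_in y).
    by exists (set_val @^-1` U) => //; exists U.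
  have ex V : exists W, D V -> [/\ open W, set_val @^-1` W = V &
      exists2 U, C U & W `<=` U].
    have [DV|] := pselect (D V); last by exists set0.
    have [G oG GV] := oD V DV.
    have [_ [U CU <-] VU] := DC V DV.
    (* Cutting the extension down by [U] keeps it inside a member of [C] without changing its trace
       on [K]. *)
    exists (G `&` U) => _; split; first by apply: openI => //; exact: oC.
      rewrite preimage_setI GV; exact/setIidPl.
    by exists U => // x [].
  have [h hP] := choice ex.
  exists (h @` D); split.
  - by move=> _ [V DV <-]; case: (hP V DV).
  - move=> x Kx; have [y <-] := set_type_inE Kx; have [V DV Vy] := covD y I.
    by exists (h V); [exists V|have [_ hV _] := hP V DV; rewrite -hV in Vy].
  - by move=> _ [V DV <-]; case: (hP V DV).
  - move=> x Kx; have [y <-] := set_type_inE Kx; apply: card_le_sub_image (Dn y I).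
    move=> _ [[V DV <-] hy]; exists V => //; split => //.
    by have [_ <- _] := hP V DV.
have ex U : exists G, C U -> open G /\ set_val @^-1` G = U.
  have [CU|] := pselect (C U); last by exists set0.
  by have [G oG GU] := oC U CU; exists G.
have [g gP] := choice ex.
have [|||D [oD covD DC Dn]] := dK (g @` C).
- exact: finite_image.
- by move=> _ [U CU <-]; case: (gP U CU).
- move=> x Kx; have [y <-] := set_type_inE Kx; have [U CU Uy] := covC y I.
  by exists (g U); [exists U|have [_ gU] := gP U CU; rewrite -gU in Uy].
exists ((fun V => set_val @^-1` V) @` D); split.
- by move=> _ [V DV <-]; exists V => //; exact: oD.
- move=> y _; have [V DV Vy] := covD _ (set_val_in y).
  by exists (set_val @^-1` V) => //; exists V.
- move=> _ [V DV <-]; have [_ [U CU <-] VU] := DC V DV.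
  by exists U => //; have [_ <-] := gP U CU; exact: preimage_subset.
- move=> y _; apply: card_le_sub_image (Dn _ (set_val_in y)).
  by move=> _ [[V DV <-] Vy]; exists V.
Qed.

(** * Partitions whose complement has refinements of smaller order *)

Lemma partition_step (X : topologicalType) (n : nat) (A B : set X)
    (C : set (set X)) :
  compact [set: X] -> hausdorff_space X -> covdim_in n.+1 [set: X] ->
  closed A -> closed B -> A `&` B = set0 ->
  finite_set C -> C `<=` open -> [set: X] `<=` \bigcup_(U in C) U ->
  exists U V, [/\ open U /\ Fsigma U, open V /\ Fsigma V, U `&` V = set0,
    A `<=` U /\ B `<=` V & order_refinement n (~` (U `|` V)) C].
Proof.
move=> cX hX dX cA cB AB0 fC oC covC.
have nX := compact_normal hX cX.
(* Each member of this cover misses [A] or misses [B], so no member of [D] meets both. *)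
have [|||D [oD covD DC Dn]] :=
    dX ((fun U => U `&` ~` A) @` C `|` (fun U => U `&` ~` B) @` C).
- by rewrite finite_setU; split; exact: finite_image.
- by move=> _ [] [U CU <-]; apply: openI; [exact: oC|exact: closed_openC|
    exact: oC|exact: closed_openC].
- move=> x _; have [U CU Ux] := covC x I.
  have [Ax|nAx] := pselect (A x); last first.
    by exists (U `&` ~` A) => //; left; exists U.
  exists (U `&` ~` B); first by right; exists U.
  by split => // Bx; have : (A `&` B) x by []; rewrite AB0.
have ex x : exists VW : set X * set X,
    [/\ D VW.1, open VW.2, VW.2 x & closure VW.2 `<=` VW.1].
  have [V DV Vx] := covD x I.
  have [||W [oW xW WV]] := @normal_shrink X [set x] V nX _ (oD V DV).
  - exact/accessible_closed_set1/hausdorff_accessible.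
  - by move=> _ ->.
  by exists (V, W); split => //; exact: xW.
have [f fP] := choice ex.
have [x _|s [fs _ covs]] := @compact_finite_subcover X _ (fun x => (f x).2) cX.
  by case: (fP x).
pose S := [set V | D V /\ V `&` A !=set0].
(* [F] is the closed shrinking of [G]: it still contains [A], while [B] lies off [G]. *)
pose F := \bigcup_(x in s `&` [set x | S (f x).1]) closure (f x).2.
pose G := \bigcup_(V in S) V.
have cF : closed F.
  by apply: closed_bigcup => [|x _]; [exact: finite_setIl|exact: closed_closure].
have oG : open G by apply: bigcup_open => V [DV _]; exact: oD.
have FG : F `<=` G.
  by move=> y [x [sx Sx] fy]; exists (f x).1 => //; case: (fP x) => _ _ _; apply.
have AF : A `<=` F.
  move=> y Ay; have [x sx fy] := covs y I; have [Df _ _ cf] := fP x.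
  exists x; last exact: subset_closure.
  by split => //; split => //; exists y; split => //; apply: cf; exact: subset_closure.
have BG : B `<=` ~` G.
  move=> y By [V [DV [z [Vz Az]]] Vy].
  case: (DC V DV) => _ [] [U CU <-] VU; first by have [_] := VU z Vz.
  by have [_] := VU y Vy.
have [P [oP FP PG]] := normal_shrink nX cF oG FG.
have [U [oU FU FsU UP]] := normal_open_Fsigma nX cF oP FP.
have [|||V [oV FV GV VP]] := @normal_open_Fsigma X (~` G) (~` closure P) nX.
- exact: open_closedC.
- exact/closed_openC/closed_closure.
- exact: subsetC.
exists U, V; split => //.
- apply/seteqP; split => // x [/UP Px /VP]; apply; exact: subset_closure.
- by split; [exact: subset_trans AF FsU|exact: subset_trans BG GV].
(* A point off [U] is off [F], so the member of [D] found for it misses [A]. A point off [V] is in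
   [G], so one of its at most n + 1 members meets [A] and has been dropped. *)
exists [set V | D V /\ ~ S V]; split.
- by move=> W [/oD].
- move=> y nUV; have [x sx fy] := covs y I; have [Df _ _ cf] := fP x.
  exists (f x).1; last by apply: cf; exact: subset_closure.
  split => // Sx; apply: nUV; left; apply: FsU.
  by exists x => //; exact: subset_closure.
- by move=> W [DW _]; case: (DC W DW) => _ [] [U' CU' <-] WU;
    exists U' => // z /WU[].
move=> y nUV; have [V0 SV0 V0y] : G y.
  by apply: contrapT => nGy; apply: nUV; right; exact: GV.
apply: (@card_le_proper _ _ [set V | D V /\ V y] V0 n) (Dn y I).
- by move=> W [[]].
- by case: SV0.
- by move=> [[]].
Qed.

Lemma F_space_closure_disjoint (X : topologicalType) (U V : set X) :
  F_space X -> open U -> Fsigma U -> open V -> Fsigma V ->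
  U `&` V = set0 -> closure U `&` closure V = set0.
Proof.
move=> FX oU FU oV FV UV0; apply: FX => //; split.
  apply/seteqP; split => // x [cUx Vx].
  have [y UVy] := cUx V (open_nbhs_nbhs (conj oV Vx)).
  by move: UVy; rewrite UV0.
apply/seteqP; split => // x [Ux cVx].
have [y VUy] := cVx U (open_nbhs_nbhs (conj oU Ux)).
by move: VUy; rewrite setIC UV0.
Qed.

(** Stage [t] applies [partition_step] to the closures of the unions of all earlier sides. Countably
    many predecessors keep these unions F_sigma, so the F-space property makes the closures
    disjoint. *)
Lemma transfinite_partition (X : topologicalType) (n : nat) (T : Type)
    (lt : T -> T -> Prop) (Cov : T -> set (set X)) (A B : set X) :
  compact [set: X] -> hausdorff_space X -> F_space X ->
  covdim_in n.+1 [set: X] ->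
  well_founded lt -> (forall s t, [\/ lt s t, s = t | lt t s]) ->
  (forall t, countable [set s | lt s t]) ->
  (forall t, [/\ finite_set (Cov t), Cov t `<=` open &
     [set: X] `<=` \bigcup_(U in Cov t) U]) ->
  closed A -> closed B -> A `&` B = set0 ->
  exists U V, [/\ open U, open V, U `&` V = set0, A `<=` U /\ B `<=` V &
    forall t, order_refinement n (~` (U `|` V)) (Cov t)].
Proof.
move=> cX hX FX dX wf lt_total lt_countable CovP cA cB AB0.
pose good (P : set X * set X) :=
  [/\ open P.1 /\ Fsigma P.1, open P.2 /\ Fsigma P.2 & P.1 `&` P.2 = set0].
have [||U0 [V0 [gU0 gV0 UV0 [AU0 BV0] _]]] :=
    @partition_step X n A B [set setT] cX hX dX cA cB AB0 (finite_set1 _).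
- by move=> _ ->; exact: openT.
- by move=> x _; exists setT.
(* Goodness is a premise inside the existential, so that choice yields a total function [g]; pairs
   that are not good are returned unchanged. *)
have step (tP : T * (set X * set X)) : exists Q, good tP.2 ->
    [/\ good Q, tP.2.1 `<=` Q.1, tP.2.2 `<=` Q.2 &
        order_refinement n (~` (Q.1 `|` Q.2)) (Cov tP.1)].
  case: tP => t [U V] /=.
  have [[[oU FU] [oV FV] UV]|] := pselect (good (U, V)); last by exists (U, V).
  have [fC oC covC] := CovP t.
  have := partition_step cX hX dX (@closed_closure _ U) (@closed_closure _ V)
    (F_space_closure_disjoint FX oU FU oV FV UV) fC oC covC.
  move=> [U' [V' [gU' gV' UV' [UU' VV'] CUV']]]; exists (U', V') => _; split => //=.
    exact: subset_trans (@subset_closure _ U) UU'.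
  exact: subset_trans (@subset_closure _ V) VV'.
have [g gP] := choice step.
pose join (D : set T) (f : T -> set X * set X) :=
  (U0 `|` \bigcup_(s in D) (f s).1, V0 `|` \bigcup_(s in D) (f s).2).
pose F t (rec : forall s, lt s t -> set X * set X) := g (t,
  (U0 `|` [set x | exists s (st : lt s t), (rec s st).1 x],
   V0 `|` [set x | exists s (st : lt s t), (rec s st).2 x])).
pose f := Fix wf (fun=> (set X * set X)%type) F.
pose below t := join [set s | lt s t] f.
have fE t : f t = g (t, below t).
  rewrite /f Fix_eq => [|u h k hk]; last first.
    by congr F; apply: functional_extensionality_dep => s;
      apply: functional_extensionality_dep => st; exact: hk.
  congr (g (t, (U0 `|` _, V0 `|` _)));
    by apply/seteqP; split => x [s] => [[st]|st] ?; exists s => //; exists st.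
have fP t : good (below t) -> [/\ good (f t), (below t).1 `<=` (f t).1,
    (below t).2 `<=` (f t).2 &
    order_refinement n (~` ((f t).1 `|` (f t).2)) (Cov t)].
  by move=> gt; have := gP (t, below t) gt; rewrite -fE.
(* A point on the first side at stage [s] and on the second at stage [t] would be on both sides at
   the later of the two stages. The set [D] is left free: it is an initial segment in the induction
   and all of [T] at the end. *)
have disj (D : set T) : (forall s, D s -> good (below s)) ->
    (join D f).1 `&` (join D f).2 = set0.
  move=> Dg; apply/seteqP; split => // x.
  have mono s t : D t -> lt s t -> (f s).1 `<=` (f t).1 /\ (f s).2 `<=` (f t).2.
    move=> Dt st; have [_ b1 b2 _] := fP t (Dg t Dt).
    by split => y fy; [apply: b1|apply: b2]; right; exists s.
  have fdisj s : D s -> (f s).1 x -> (f s).2 x -> False.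
    move=> Ds f1 f2; have [[_ _ f12] _ _ _] := fP s (Dg s Ds).
    by have : ((f s).1 `&` (f s).2) x by []; rewrite f12.
  move=> [[U0x|[s Ds fs]] [V0x|[t Dt ft]]].
  - by rewrite -UV0.
  - apply: (fdisj t Dt) ft; have [_ b1 _ _] := fP t (Dg t Dt).
    by apply: b1; left.
  - apply: (fdisj s Ds) fs _; have [_ _ b2 _] := fP s (Dg s Ds).
    by apply: b2; left.
  - case: (lt_total s t) => [st|eq_st|ts].
    + by apply: (fdisj t Dt) ft; apply: (mono s t Dt st).1.
    + by apply: (fdisj t Dt) ft; rewrite -eq_st.
    + by apply: (fdisj s Ds) fs _; apply: (mono t s Ds ts).2.
have below_good t : good (below t).
  elim/(well_founded_ind wf): t => t IH; split => /=; last exact: disj.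
  - split.
      apply: openU; first by case: gU0.
      by apply: bigcup_open => s /IH /fP[[[]]].
    apply: FsigmaU; first by case: gU0.
    by apply: Fsigma_bigcup => // s /IH /fP[[[]]].
  - split.
      apply: openU; first by case: gV0.
      by apply: bigcup_open => s /IH /fP[[_ []]].
    apply: FsigmaU; first by case: gV0.
    by apply: Fsigma_bigcup => // s /IH /fP[[_ []]].
(* This last union may be uncountable; it is claimed to be open and disjoint, not F_sigma. *)
exists (join setT f).1, (join setT f).2; split.
- apply: openU; first by case: gU0.
  by apply: bigcup_open => s _; case: (fP s (below_good s)) => [[[]]].
- apply: openU; first by case: gV0.
  by apply: bigcup_open => s _; case: (fP s (below_good s)) => [[_ []]].
- exact: disj.
- by split=> x; [move=> /AU0|move=> /BV0]; left.
- move=> t; have [_ _ _] := fP t (below_good t); apply: order_refinementS.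
  by apply: subsetC => x [fx|fx]; [left|right]; right; exists t.
Qed.

(** * Closed subspaces: compactness, separation, the F-space property *)

Lemma nbhs_set_typeP (X : topologicalType) (K : set X) (y : set_type K)
    (B : set (set_type K)) :
  nbhs y B <-> exists G, [/\ open G, G (set_val y) & set_val @^-1` G `<=` B].
Proof.
rewrite nbhsE; split=> [[_ [[G oG <-] Gy] GB]|[G [oG Gy GB]]].
  by exists G; split.
by exists (set_val @^-1` G) => //; split => //; exists G.
Qed.

Lemma closure_set_typeP (X : topologicalType) (K : set X) (A : set (set_type K))
    (y : set_type K) :
  closure A y <-> closure (set_val @` A) (set_val y).
Proof.
split=> [Ay B By|Ay B /nbhs_set_typeP[G [oG Gy GB]]].
  move: By; rewrite nbhsE => -[G [oG Gy] GB].
  have [|z [Az Gz]] := Ay (set_val @^-1` G).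
    by apply/nbhs_set_typeP; exists G; split.
  by exists (set_val z); split; [exists z|exact: GB].
have [_ [[z Az <-] Gz]] := Ay G (open_nbhs_nbhs (conj oG Gy)).
by exists z; split => //; exact: GB.
Qed.

Lemma compact_set_type (X : topologicalType) (K : set X) :
  compact K -> compact [set: set_type K].
Proof.
move=> cK F PF _; have [|x [Kx Fx]] := cK (set_val @ F) (fmap_proper_filter _ PF).
  apply: (@filterS _ F _ [set: set_type K] _ _ filterT) => y _; exact: set_val_in.
have [y yx] := set_type_inE Kx; exists y; split => // A B FA.
move=> /nbhs_set_typeP[G [oG Gy GB]].
have [||_ [[z Az <-] Gz]] := Fx (set_val @` A) G.
- by apply: (@filterS _ F _ A) FA => z Az; exists z.
- by apply: open_nbhs_nbhs; split => //; rewrite -yx.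
- by exists z; split => //; exact: GB.
Qed.

Lemma hausdorff_set_type (X : topologicalType) (K : set X) :
  hausdorff_space X -> hausdorff_space (set_type K).
Proof.
move=> hX y z yz; apply/val_inj; rewrite -set_valE; apply: hX => A B Ay Bz.
move: Ay Bz; rewrite !nbhsE => -[G [oG Gy] GA] [H [oH Hz] HB].
have [||w [Gw Hw]] := yz (set_val @^-1` G) (set_val @^-1` H).
- by apply/nbhs_set_typeP; exists G; split.
- by apply/nbhs_set_typeP; exists H; split.
- by exists (set_val w); split; [exact: GA|exact: HB].
Qed.

Lemma closed_set_val_image (X : topologicalType) (K : set X)
    (A : set (set_type K)) : closed K -> closed A -> closed (set_val @` A).
Proof.
move=> cK cA x Ax.
have Kx : K x.
  by apply: cK; apply: closureS Ax => _ [y _ <-]; exact: set_val_in.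
have [y yx] := set_type_inE Kx; exists y => //; apply: cA.
by apply/closure_set_typeP; rewrite yx.
Qed.

(** Since [K] is closed, F_sigma sets of the subspace are F_sigma in [X], and closures in [K] agree
    with closures in [X]. *)
Lemma F_space_set_type (X : topologicalType) (K : set X) :
  closed K -> F_space X -> F_space (set_type K).
Proof.
move=> cK FX A B FA FB [AB BA].
have FsX (D : set (set_type K)) : Fsigma D -> Fsigma (set_val @` D).
  move=> [G cG ->]; exists (fun n => set_val @` G n).
    by move=> n; exact: closed_set_val_image.
  by rewrite image_bigcup.
have FX' : closure (set_val @` A) `&` closure (set_val @` B) = set0.
  apply: FX (FsX _ FA) (FsX _ FB) _; split; apply/seteqP; split => //.
    move=> x [clA [y By yx]]; rewrite -yx in clA; have : (closure A `&` B) y.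
      by split => //; exact/closure_set_typeP.
    by rewrite AB.
  move=> _ [[y Ay <-] clB]; have : (A `&` closure B) y.
    by split => //; exact/closure_set_typeP.
  by rewrite BA.
apply/seteqP; split => // y [/closure_set_typeP Ay /closure_set_typeP By].
have : (closure (set_val @` A) `&` closure (set_val @` B)) (set_val y) by [].
by rewrite FX'.
Qed.

(** * Cofinal families of finite covers, and Ind <= dim *)

(** Empty members are exempt because traces on a subspace may be empty, and because an empty [C]
    covers the empty space. *)
Definition cofinal_covers (X : topologicalType) (T : Type)
    (Cov : T -> set (set X)) : Prop :=
  (forall t, [/\ finite_set (Cov t), Cov t `<=` open &
    [set: X] `<=` \bigcup_(U in Cov t) U]) /\
  (forall C : set (set X), finite_set C -> C `<=` open ->
    [set: X] `<=` \bigcup_(U in C) U ->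
    exists t, forall W, Cov t W -> W !=set0 -> exists2 U, C U & W `<=` U).

(** A cover of [K] is extended to [X] by adding the complement of [K]. The index type [T] stays the
    same, so one well-order serves all iterated boundaries. *)
Lemma cofinal_covers_set_type (X : topologicalType) (T : Type)
    (Cov : T -> set (set X)) (K : set X) : closed K -> cofinal_covers Cov ->
  cofinal_covers
    (fun t => (fun U => set_val @^-1` U : set (set_type K)) @` Cov t).
Proof.
move=> cK [CovP Cov_cofinal]; split=> [t|C fC oC covC].
  have [fC oC covC] := CovP t; split; first exact: finite_image.
    by move=> _ [U CU <-]; exists U => //; exact: oC.
  move=> y _; have [U CU Uy] := covC (set_val y) I.
  by exists (set_val @^-1` U) => //; exists U.
have ex U : exists G, C U -> open G /\ set_val @^-1` G = U.
  have [CU|] := pselect (C U); last by exists set0.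
  by have [G oG GU] := oC U CU; exists G.
have [g gP] := choice ex.
have [|||t tP] := Cov_cofinal (g @` C `|` [set ~` K]).
- by rewrite finite_setU; split; [exact: finite_image|exact: finite_set1].
- move=> _ [[U CU <-]|->]; first by case: (gP U CU).
  exact: closed_openC.
- move=> x _; have [Kx|nKx] := pselect (K x); last by exists (~` K) => //; right.
  have [y yx] := set_type_inE Kx; have [U CU Uy] := covC y I.
  exists (g U); first by left; exists U.
  by have [_ gU] := gP U CU; rewrite -gU in Uy; rewrite -yx.
exists t => _ [W tW <-] [y Wy].
have [|_ [[U CU <-]|->] WU] := tP W tW; first by exists (set_val y).
  by exists U => //; have [_ <-] := gP U CU; exact: preimage_subset.
by case: (WU _ Wy); exact: set_val_in.
Qed.

Lemma boundary_closed (X : topologicalType) (U : set X) : closed (boundary U).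
Proof. by apply: closedI; exact: closed_closure. Qed.

Lemma boundary_sub (X : topologicalType) (U V : set X) :
  open U -> open V -> U `&` V = set0 -> boundary U `<=` ~` (U `|` V).
Proof.
move=> oU oV UV0 x [clU clCU] [Ux|Vx].
  by have [y []] := clCU U (open_nbhs_nbhs (conj oU Ux)).
by have [y] := clU V (open_nbhs_nbhs (conj oV Vx)); rewrite UV0.
Qed.

Lemma covdim_in_cofinal (X : topologicalType) (n : nat) (T : Type)
    (Cov : T -> set (set X)) (K : set X) :
  cofinal_covers Cov -> closed K ->
  (forall t, order_refinement n K (Cov t)) -> covdim_in n K.
Proof.
move=> [_ Cov_cofinal] cK KCov C fC oC covC.
have [|||t tP] := Cov_cofinal (C `|` [set ~` K]).
- by rewrite finite_setU; split => //; exact: finite_set1.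
- by move=> U [/oC//|->]; exact: closed_openC.
- move=> x _; have [/covC[U CU Ux]|nKx] := pselect (K x).
    by exists U => //; left.
  by exists (~` K) => //; right.
have [D [oD covD DC Dn]] := KCov t.
(* A member that meets [K] cannot lie inside the complement of [K], hence lies inside a member of
   [C]. *)
exists [set V | D V /\ V `&` K !=set0]; split.
- by move=> V [/oD].
- move=> x Kx; have [V DV Vx] := covD x Kx.
  by exists V => //; split => //; exists x.
- move=> V [DV [x [Vx Kx]]]; have [W tW VW] := DC V DV.
  have [|U [CU|->] WU] := tP W tW; first by exists x; exact: VW.
    by exists U => //; exact: subset_trans WU.
  by case: (WU x (VW x Vx)).
- move=> x Kx; apply: card_le_trans (Dn x Kx); apply: subset_card_le.
  by move=> V [[]].
Qed.

(** The induction varies [X] and [Cov] together: the boundary of one side of the partition is again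
    a compact Hausdorff F-space, with the traces of [Cov] as cofinal covers. *)
Lemma covdim_le_Ind_le (T : Type) (lt : T -> T -> Prop) (n : nat) :
  well_founded lt -> (forall s t, [\/ lt s t, s = t | lt t s]) ->
  (forall t, countable [set s | lt s t]) ->
  forall (X : topologicalType) (Cov : T -> set (set X)),
  compact [set: X] -> hausdorff_space X -> F_space X -> cofinal_covers Cov ->
  covdim_le n X -> Ind_le n X.
Proof.
move=> wf lt_total lt_countable; elim: n => [//|n IH] X Cov cX hX FX CovP.
move=> /covdim_leE dX A V cA oV AV.
have [|U [W [oU oW UW0 [AU VW] UWCov]]] := transfinite_partition cX hX FX dX
  wf lt_total lt_countable CovP.1 cA (open_closedC oV).
  by apply/seteqP; split => // x [/AV].
exists U; split => //.
  move=> x Ux; apply: contrapT => /VW Wx.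
  by have : (U `&` W) x by []; rewrite UW0.
have cbd := @boundary_closed X U.
apply: (IH _ _ _ _ _ (cofinal_covers_set_type cbd CovP)).
- exact/compact_set_type/(subclosed_compact cbd cX).
- exact: hausdorff_set_type.
- exact: F_space_set_type.
apply/covdim_le_set_type/(covdim_in_cofinal CovP cbd) => t.
exact: order_refinementS (boundary_sub oU oW UW0) (UWCov t).
Qed.

(** * ind <= Ind *)

Lemma Ind_le_ind_le (n : nat) (X : topologicalType) :
  hausdorff_space X -> Ind_le n X -> ind_le n X.
Proof.
elim: n X => [//|n IH] X hX IX x V oV Vx.
have [||U [oU xU UV IU]] := IX [set x] V _ oV.
- exact/accessible_closed_set1/hausdorff_accessible.
- by move=> _ ->.
by exists U; split => //; [exact: xU|apply: IH IU; exact: hausdorff_set_type].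
Qed.

(** * The finite sum theorem for closed sets, and dim <= ind *)

Lemma covdim_in_shrink (X : topologicalType) (n : nat) (K L : set X)
    (C : set (set X)) :
  closed K -> covdim_in n K -> K `<=` L ->
  finite_set C -> C `<=` open -> L `<=` \bigcup_(U in C) U ->
  exists p : set X -> set X, [/\ forall U, C U -> open (p U) /\ p U `<=` U,
    L `<=` \bigcup_(U in C) p U &
    forall x, K x -> [set V | (p @` C) V /\ V x] #<= `I_n].
Proof.
move=> cK dK KL fC oC covC.
have [D [oD covD DC Dn]] := dK C fC oC (subset_trans KL covC).
have ex V : exists U, D V -> C U /\ V `<=` U.
  have [DV|] := pselect (D V); last by exists set0.
  by have [U CU VU] := DC V DV; exists U.
have [a aP] := choice ex.
(* On [K], [U] is cut down to the members of [D] assigned to it; off [K] it is unchanged, so that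
   all of [L] remains covered. *)
pose p U := U `&` (\bigcup_(V in D `&` [set V | a V = U]) V `|` ~` K).
exists p; split.
- move=> U CU; split; last by move=> x [].
  apply: openI; first exact: oC.
  apply: openU; last exact: closed_openC.
  by apply: bigcup_open => V [/oD].
- move=> x Lx; have [Kx|nKx] := pselect (K x); last first.
    by have [U CU Ux] := covC x Lx; exists U => //; split => //; right.
  have [V DV Vx] := covD x Kx; have [CaV VaV] := aP V DV.
  by exists (a V) => //; split; [exact: VaV|left; exists V].
- move=> x Kx; apply: (@card_le_sub_image _ _ _ _ (p \o a)) (Dn x Kx).
  move=> _ [[U CU <-] [_ [[V [DV VU] Vx]|//]]]; exists V => //=.
  by rewrite VU.
Qed.

(** The cover is shrunk for [K] and then for [L]; the second shrinking only makes members smaller,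
    so the order on [K] survives. *)
Lemma covdim_inU (X : topologicalType) (n : nat) (K L : set X) :
  closed K -> closed L -> covdim_in n K -> covdim_in n L ->
  covdim_in n (K `|` L).
Proof.
move=> cK cL dK dL C fC oC covC.
have [p [pP pcov pn]] := covdim_in_shrink cK dK (@subsetUl _ K L) fC oC covC.
have [|||q [qP qcov qn]] :=
    @covdim_in_shrink X n L (K `|` L) (p @` C) cL dL (@subsetUr _ K L).
- exact: finite_image.
- by move=> _ [U /pP[oU _] <-].
- by move=> x /pcov[U CU pU]; exists (p U) => //; exists U.
exists (q @` (p @` C)); split.
- by move=> _ [V /qP[oV _] <-].
- by move=> x /qcov[V pCV qV]; exists (q V) => //; exists V.
- move=> _ [V pCV <-]; have [_ qV] := qP V pCV.
  case: pCV qV => U CU <- qU; exists U => //.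
  by apply: subset_trans qU _; case: (pP U CU).
- move=> x [Kx|]; last exact: qn.
  apply: (@card_le_sub_image _ _ _ _ q) (pn x Kx).
  move=> _ [[V pCV <-] qVx]; exists V => //; split => //.
  by case: (qP V pCV) => _; apply.
Qed.

Lemma covdim_in0 (X : topologicalType) (n : nat) : covdim_in n (@set0 X).
Proof. by move=> C _ _ _; exists set0; split. Qed.

Lemma covdim_in_bigcup (X : topologicalType) (I : choiceType) (n : nat)
    (s : set I) (K : I -> set X) : finite_set s ->
  (forall i, s i -> closed (K i)) -> (forall i, s i -> covdim_in n (K i)) ->
  covdim_in n (\bigcup_(i in s) K i).
Proof.
move=> /finite_seqP[l ->]; elim: l => [|i l IH] cK dK.
  rewrite bigcup0 => [|i]; first exact: covdim_in0.
  by rewrite /= in_nil.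
have -> : [set` i :: l] = i |` [set` l].
  apply/seteqP; split => j /=; rewrite in_cons; first by case/predU1P; [left|right].
  by case=> [->|->]; rewrite ?eqxx ?orbT.
rewrite bigcup_setU1; apply: covdim_inU.
- by apply: cK; rewrite /= mem_head.
- apply: closed_bigcup; first exact: finite_seq.
  by move=> j jl; apply: cK; rewrite /= in_cons orbC jl.
- by apply: dK; rewrite /= mem_head.
- by apply: IH => j jl; [apply: cK|apply: dK]; rewrite /= in_cons orbC jl.
Qed.

(** The order bound on [K] is extended to all of [X]: it persists on a neighbourhood of [K] for
    finitely many pieces with closures inside the members, and the family is cut down to that
    neighbourhood. *)
Lemma covdim_in_swell (X : topologicalType) (n : nat) (K : set X)
    (C : set (set X)) :
  compact [set: X] -> hausdorff_space X -> closed K -> covdim_in n K ->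
  finite_set C -> C `<=` open -> K `<=` \bigcup_(U in C) U ->
  exists D : set (set X),
    [/\ D `<=` open, K `<=` \bigcup_(V in D) V,
        forall V, D V -> exists2 U, C U & V `<=` U &
        forall x, [set V | D V /\ V x] #<= `I_n].
Proof.
move=> cX hX cK dK fC oC covC; have nX := compact_normal hX cX.
have [D [oD covD DC Dn]] := dK C fC oC covC.
have ex x : exists VW : set X * set X, K x ->
    [/\ D VW.1, open VW.2, VW.2 x & closure VW.2 `<=` VW.1].
  have [Kx|] := pselect (K x); last by exists (set0, set0).
  have [V DV Vx] := covD x Kx.
  have [||W [oW xW WV]] := @normal_shrink X [set x] V nX _ (oD V DV).
  - exact/accessible_closed_set1/hausdorff_accessible.
  - by move=> _ ->.
  by exists (V, W); split => //; exact: xW.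
have [f fP] := choice ex.
have [x /fP[]//|s [fs sK covs]] := @compact_finite_subcover X K (fun x => (f x).2)
  (subclosed_compact cK cX (@subsetT _ K)).
pose E V := \bigcup_(x in s `&` [set x | (f x).1 = V]) (f x).2.
pose M y := (fun x => (f x).1) @` (s `&` [set x | closure (f x).2 y]).
pose G := interior [set y | M y #<= `I_n].
have KG : K `<=` G.
  move=> y Ky.
  (* On [N] only closures that contain [y] occur, and these belong to members of [D] through [y]. *)
  pose N := ~` \bigcup_(x in s `&` [set x | ~ closure (f x).2 y]) closure (f x).2.
  have oN : open N.
    apply/closed_openC/closed_bigcup => [|x _]; first exact: finite_setIl.
    exact: closed_closure.
  have Ny : N y by move=> [x []].
  apply: filterS (open_nbhs_nbhs (conj oN Ny)) => z Nz /=.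
  apply: card_le_trans (Dn y Ky); apply: subset_card_le => _ [x [sx fz] <-].
  have [Df _ _ cf] := fP x (sK x sx); split => //; apply: cf.
  by apply: contrapT => nfy; apply: Nz; exists x.
have oE V : open (E V).
  by apply: bigcup_open => x [/sK/fP[]].
exists ((fun V => E V `&` G) @` ((fun x => (f x).1) @` s)); split.
- by move=> _ [V _ <-]; apply: openI => //; exact: open_interior.
- move=> y Ky; have [x sx fy] := covs y Ky.
  exists (E (f x).1 `&` G); last by split; [exists x|exact: KG].
  by exists (f x).1 => //; exists x.
- move=> _ [_ [x sx <-] <-]; have [Df _ _ _] := fP x (sK x sx).
  have [U CU fU] := DC _ Df; exists U => // z [[w [sw fw] Wz] _].
  apply: fU; rewrite -fw; have [_ _ _ cf] := fP w (sK w sw).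
  by apply: cf; exact: subset_closure.
- move=> y; have [Gy|nGy] := pselect (G y); last first.
    apply: (@card_le_trans _ _ _ (@set0 nat)); last by [].
    by apply: (@card_le_trans _ _ _ (@set0 (set X))) => //;
      apply: subset_card_le => _ [[V _ <-] []].
  apply: (@card_le_sub_image _ _ (M y) _ (fun V => E V `&` G)); last first.
    exact: (interior_subset Gy).
  move=> _ [[V _ <-] [[x [sx <-] fy] _]]; exists (f x).1 => //.
  by exists x => //; split => //; exact: subset_closure.
Qed.

(* Removing from each set the closures of its predecessors in the list costs
   only boundary points. *)
Lemma disjoint_refinement (X : topologicalType) (I : choiceType) (l : seq I)
    (P : I -> set X) : (forall i, i \in l -> open (P i)) ->
  exists E : set (set X), [/\ E `<=` open,
    forall V, E V -> exists2 i, i \in l & V `<=` P i,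
    forall x, is_subset1 [set V | E V /\ V x] &
    \bigcup_(i in [set` l]) P i `\` \bigcup_(i in [set` l]) boundary (P i)
      `<=` \bigcup_(V in E) V].
Proof.
elim: l => [|i l IH] oP.
  by exists set0; split => [//|//|x V W [//]|x [[i /=]]]; rewrite in_nil.
have [j jl|E [oE El E1 Ecov]] := IH; first by apply: oP; rewrite in_cons jl orbT.
have oPi : open (P i) by apply: oP; rewrite mem_head.
exists (P i |` ((fun V => V `\` closure (P i)) @` E)); split.
- move=> V [->//|[W EW <-]]; apply: openI; first exact: oE.
  exact/closed_openC/closed_closure.
- move=> V [->|[W EW <-]]; first by exists i => //; rewrite mem_head.
  have [j jl Wj] := El W EW; exists j; first by rewrite in_cons jl orbT.
  by move=> x [/Wj].
- move=> x V W [[->|[V' EV' <-]] Vx] [[->|[W' EW' <-]] Wx] //.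
  + by case: Wx => _ []; exact: subset_closure.
  + by case: Vx => _ []; exact: subset_closure.
  + by rewrite (E1 x V' W') //; split => //; [case: Vx|case: Wx].
- move=> x [[j jl Pjx] nbd].
  have [Pix|nPix] := pselect (P i x); first by exists (P i) => //; left.
  have ncPi : ~ closure (P i) x.
    move=> cPix; apply: nbd; exists i; first by rewrite /= mem_head.
    by split => //; exact: subset_closure.
  have [|V EV Vx] := Ecov x.
    split; last first.
      by move=> [k kl Bk]; apply: nbd; exists k => //; rewrite /= in_cons kl orbT.
    exists j => //; move: jl; rewrite /= in_cons => /orP[/eqP ji|//].
    by case: nPix; rewrite -ji.
  by exists (V `\` closure (P i)) => //; right; exists V.
Qed.

(** Finitely many small neighbourhoods cover [X]. The union [K] of their boundaries is handled by
    the sum theorem, with at most n members through any point; the rest is covered by disjoint open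
    sets, which add at most one. *)
Lemma ind_le_covdim_le (n : nat) (X : topologicalType) :
  compact [set: X] -> hausdorff_space X -> ind_le n X -> covdim_le n X.
Proof.
elim: n X => [//|n IH] X cX hX iX; apply/covdim_leE => C fC oC covC.
have ex x : exists U : set X, [/\ open U, U x, exists2 V, C V & U `<=` V &
    covdim_in n (boundary U)].
  have [V CV Vx] := covC x I; have [U [oU Ux UV iU]] := iX x V (oC V CV) Vx.
  exists U; split => //; first by exists V.
  apply/covdim_le_set_type/IH => //; last exact: hausdorff_set_type.
  exact/compact_set_type/(subclosed_compact (@boundary_closed _ U) cX).
have [P PP] := choice ex.
have [x _|s [fs _ covs]] := @compact_finite_subcover X _ P cX.
  by case: (PP x).
pose K := \bigcup_(x in s) boundary (P x).
have cK : closed K by apply: closed_bigcup => // x _; exact: boundary_closed.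
have dK : covdim_in n K.
  apply: covdim_in_bigcup => // x _; first exact: boundary_closed.
  by case: (PP x).
have [|D [oD covD DC Dn]] := covdim_in_swell cX hX cK dK fC oC.
  by move=> x _; exact: covC.
have /finite_seqP[l sl] := fs.
have [x _|E [oE El E1 Ecov]] := @disjoint_refinement X X l P.
  by case: (PP x).
exists (D `|` E); split.
- by move=> V [/oD|/oE].
- move=> x _; have [/covD[V DV Vx]|nKx] := pselect (K x).
    by exists V => //; left.
  have [|V EV Vx] := Ecov x; last by exists V => //; right.
  by split; [rewrite -sl; exact: covs|rewrite -sl].
- move=> V [/DC//|/El[x _ VP]]; have [_ _ [U CU PU] _] := PP x.
  by exists U => //; exact: subset_trans PU.
- move=> x _; apply: card_leU1 (Dn x) (E1 x).
  by move=> V [[DV|EV] Vx]; [left|right].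
Qed.

(** * Well-orders with countable initial segments *)

(** Unique least elements of singletons and pairs make [R] reflexive, total and antisymmetric; its
    strict part is the required relation. *)
Lemma exists_well_founded_trichotomy (T : eqType) : exists lt : T -> T -> Prop,
  well_founded lt /\ forall s t, [\/ lt s t, s = t | lt t s].
Proof.
have [R Rwo] := well_ordering_principle T.
have Rmin (A : pred T) x : x \in A ->
    exists z, [/\ z \in A, forall y, y \in A -> R z y &
    forall y, y \in A -> (forall w, w \in A -> R y w) -> y = z].
  move=> Ax; have [|z [[Az zA] zU]] := Rwo A; first by exists x.
  by exists z; split => // y Ay yA; rewrite (zU y).
have Rxx x : R x x.
  by have [z [/eqP-> + _]] := Rmin (pred1 x) x (eqxx x); apply; exact: eqxx.
have Rtotal x y : R x y \/ R y x.
  have [|z [+ zR _]] := Rmin (pred2 x y) x; first by rewrite inE eqxx.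
  by rewrite inE => /orP[] /eqP zE; rewrite zE in zR; [left|right]; apply: zR;
    rewrite inE eqxx ?orbT.
have Ranti x y : R x y -> R y x -> x = y.
  move=> xy yx; have [|z [_ _ zU]] := Rmin (pred2 x y) x.
    by rewrite inE eqxx.
  rewrite (zU x); [rewrite (zU y) //| |].
  - by rewrite inE eqxx orbT.
  - by move=> w; rewrite inE => /orP[] /eqP->.
  - by rewrite inE eqxx.
  - by move=> w; rewrite inE => /orP[] /eqP->.
exists (fun x y => R x y /\ x <> y); split.
  move=> x; apply: contrapT => nAx.
  pose A := [pred x | `[< ~ Acc (fun x y => R x y /\ x <> y) x >]].
  have [|z [Az zA _]] := Rmin A x; first exact/asboolP.
  move: (Az) => /asboolP; apply; constructor => y [yz nyz].
  apply: contrapT => nAy; apply/nyz/Ranti => //; apply: zA; exact/asboolP.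
move=> s t; have [->|/eqP st] := eqVneq s t; first exact: Or32.
case: (Rtotal s t) => Rst; [apply: Or31|apply: Or33]; split => //.
by move=> ts; apply: st.
Qed.

(** If some initial segment is uncountable, the first such one has size continuum by CH, and its
    order is pulled back to [set nat] along a bijection. *)
Lemma CH_well_order : continuum_hypothesis ->
  exists lt : set nat -> set nat -> Prop, [/\ well_founded lt,
    forall s t, [\/ lt s t, s = t | lt t s] &
    forall t, countable [set s | lt s t]].
Proof.
move=> CH; have [lt [wf lt_total]] := exists_well_founded_trichotomy (set nat).
have [[a [na aP]]|nex] := pselect (exists a, ~ countable [set s | lt s a] /\
    forall b, lt b a -> countable [set s | lt s b]); last first.
  exists lt; split => //; elim/(well_founded_ind wf) => t IH.
  by apply: contrapT => nt; apply: nex; exists t.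
have /pcard_eqP[h] : continuum #= [set s | lt s a].
  by rewrite card_eq_sym; case: (CH [set s | lt s a]).
have hI x y : h x = h y -> x = y.
  by have hI : {in continuum &, injective h} by []; apply: hI; exact: mem_set.
exists (fun s t => lt (h s) (h t)); split.
- move=> s; move: (wf (h s)); move Eu : (h s) => u Au.
  elim: Au s Eu => {}u _ IH s su; constructor => t ts.
  by apply: IH (erefl (h t)); rewrite -su.
- move=> s t; case: (lt_total (h s) (h t)) => [?|hst|?].
  + exact: Or31.
  + by apply: Or32; exact: hI.
  + exact: Or33.
- move=> t; have /aP : lt (h t) a 
    by have : [set s | lt s a] (h t) by exact: (@funS _ _ _ _ h t I).
  apply: sub_countable.
  have hi : {in [set s | lt (h s) (h t)] &, injective h}.
    by move=> x y _ _; exact: hI.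
  rewrite -(card_le_eql (inj_card_eq hi)); apply: subset_card_le.
  by move=> _ [s st <-].
Qed.

(** * Cofinal covers indexed by sets of naturals *)

Lemma basis_cofinal_covers (X : topologicalType) (B : set (set X)) :
  compact [set: X] -> basis B -> B #<= continuum ->
  exists Cov : set nat -> set (set X), cofinal_covers Cov.
Proof.
move=> cX [oB nB] /pcard_surjP[g gB].
(* One set of naturals codes a sequence of such sets, each naming a set through [g]. A code whose
   family is not a finite open cover is given the trivial cover. *)
pose dec (s : set nat) (i : nat) : set nat := [set m | s (pickle (i, m))].
pose fam s := range (fun i => g (dec s i)).
pose ok C := [/\ finite_set C, C `<=` open & [set: X] `<=` \bigcup_(U in C) U].
exists (fun s => if pselect (ok (fam s)) then fam s else [set setT]); split.
  move=> s; case: pselect => [//|?] /=; split.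
  - exact: finite_set1.
  - by move=> _ ->; exact: openT.
  - by move=> x _; exists setT.
move=> C fC oC covC.
have [[x0 _]|X0] := pselect ([set: X] !=set0); last first.
  by exists set0 => W _ [x _]; case: X0; exists x.
have ex x : exists V, [/\ B V, V x & exists2 U, C U & V `<=` U].
  have [U CU Ux] := covC x I.
  have [V [BV Vx] VU] := nB x U (open_nbhs_nbhs (conj (oC U CU) Ux)).
  by exists V; split => //; exists U.
have [f fP] := choice ex.
have [x _|s [fs _ covs]] := @compact_finite_subcover X _ f cX.
  by have [/oB] := fP x.
have /finite_seqP[l sl] := fs.
have exc i : exists c, g c = f (nth x0 l i).
  by have [/gB[c _ gc] _ _] := fP (nth x0 l i); exists c.
have [c cP] := choice exc.
(* [t] codes the list [l] padded by [x0]; the padding adds only [f x0], which also lies inside a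
   member of [C]. *)
pose t : set nat := [set k | exists i m, k = pickle (i, m) /\ c i m].
have dect i : dec t i = c i.
  apply/seteqP; split => m /=; last by exists i, m.
  by move=> [j [k [/(pcan_inj pickleK)[-> ->]]]].
have famE : fam t = range (fun i => f (nth x0 l i)).
  by apply: eq_imagel => i _; rewrite dect cP.
have okt : ok (fam t).
  rewrite famE; split.
  - apply: (@sub_finite_set _ _ (f @` (x0 |` s))).
      move=> _ [i _ <-]; exists (nth x0 l i) => //; rewrite sl.
      have [il|il] := ltnP i (size l); first by right; exact: mem_nth.
      by left; rewrite nth_default.
    by apply: finite_image; rewrite finite_setU; split => //; exact: finite_set1.
  - by move=> _ [i _ <-]; apply: oB; case: (fP (nth x0 l i)).
  - move=> x _; have [y + fyx] := covs x I; rewrite sl => yl.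
    exists (f y) => //; exists (index y l) => //.
    by rewrite nth_index.
exists t; case: pselect => [? W|//] /=; rewrite famE => -[i _ <-] _.
by case: (fP (nth x0 l i)).
Qed.

Theorem theorem2p1 (CH : continuum_hypothesis) (X : topologicalType)
    (X_compact : compact [set: X]) (X_hausdorff : hausdorff_space X)
    (X_F : F_space X) (X_weight : has_weight X continuum) :
  covering_dimension X = small_inductive_dimension X /\
  small_inductive_dimension X = large_inductive_dimension X.
Proof.
have [lt [wf lt_total lt_countable]] := CH_well_order CH.
have [[B bB Bc] _] := X_weight.
have [|Cov CovP] := basis_cofinal_covers X_compact bB.
  by rewrite (card_le_eql Bc).
have cov_Ind n : covdim_le n X -> Ind_le n X.
  exact: (covdim_le_Ind_le wf lt_total lt_countable X_compact X_hausdorff X_F CovP).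
have Ind_ind n := @Ind_le_ind_le n X X_hausdorff.
have ind_cov n := @ind_le_covdim_le n X X_compact X_hausdorff.
(* The three bounds are equivalent at every index, so the values agree, the infinite one
   included. *)
split; congr dim_value; apply: functional_extensionality_dep => n;
  apply: propositional_extensionality.
  by split; [move=> /cov_Ind/Ind_ind|exact: ind_cov].
by split; [move=> /ind_cov/cov_Ind|exact: Ind_ind].
Qed.
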